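(* Let $(Q,\cdot,\backslash,/)$ be an algebra with three binary operations. Consider the following identities, each required to hold for all $x,y\in Q$: $$\text{(A)}\ x\cdot(x\backslash y)=y,\qquad \text{(C)}\ (y/x)\cdot x=y,\qquad \text{(B)}\ x\backslash(x\cdot y)=y,$$ $$\text{(D)}\ (y\cdot x)/x=y,\qquad \text{(T)}\ x/(y\backslash x)=y,\qquad \text{(R)}\ (x/y)\backslash x=y.$$ Then each of the following holds: 1. If $(Q,\cdot,\backslash,/)$ satisfies (A), (C), (B) and (T), then it is a quasigroup. 2. If $(Q,\cdot,\backslash,/)$ satisfies (C), (B), (D) and (T), then it is a quasigroup. 3. If $(Q,\cdot,\backslash,/)$ satisfies (A), (C), (D) and (R), then it is a quasigroup. 4. If $(Q,\cdot,\backslash,/)$ satisfies (A), (B), (D) and (R), then it is a quasigroup. 5. If $(Q,\cdot,\backslash,/)$ satisfies (A), (B), (T) and (R), then it is a quasigroup. 6. If $(Q,\cdot,\backslash,/)$ satisfies (A), (D), (T) and (R), then it is a quasigroup. 7. If $(Q,\cdot,\backslash,/)$ satisfies (C), (B), (T) and (R), then it is a quasigroup. 8. If $(Q,\cdot,\backslash,/)$ satisfies (C), (D), (T) and (R), then it is a quasigroup.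
   Context: An algebra $(Q,\cdot,\backslash,/)$ is a set $Q$ with three binary operations $\cdot,\backslash,/ : Q\times Q\to Q$. Such an algebra is called a quasigroup (in the equational sense of T. Evans) if the following four identities hold for all $x,y\in Q$: $x\cdot(x\backslash y)=y$; $(y/x)\cdot x=y$; $x\backslash(x\cdot y)=y$; $(y\cdot x)/x=y$. *)

(* Defs.v *)
Section Identities.

Context {Q : Type} (mul ldiv rdiv : Q -> Q -> Q).

Local Infix "*" := mul.
(* [x \ y] divides on the left by [x]; [y / x] divides on the right by [x]. *)
Local Infix "\" := ldiv (at level 40, left associativity).
Local Infix "/" := rdiv.

Definition idA : Prop := forall x y : Q, x * (x \ y) = y.
Definition idC : Prop := forall x y : Q, (y / x) * x = y.
Definition idB : Prop := forall x y : Q, x \ (x * y) = y.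
Definition idD : Prop := forall x y : Q, (y * x) / x = y.
Definition idT : Prop := forall x y : Q, x / (y \ x) = y.
Definition idR : Prop := forall x y : Q, (x / y) \ x = y.

Record is_quasigroup : Prop := {
  quasigroup_mul_ldiv : forall x y : Q, x * (x \ y) = y;
  quasigroup_rdiv_mul : forall x y : Q, (y / x) * x = y;
  quasigroup_ldiv_mul : forall x y : Q, x \ (x * y) = y;
  quasigroup_mul_rdiv : forall x y : Q, (y * x) / x = y
}.

End Identities.

(* Main.v *)
Require Import Defs.

(** The identities (T) and (R) say that, for a fixed element [x], the maps
    [y |-> y \ x] and [y |-> x / y] undo each other in one of the two orders.
    Each of them carries facts about one division over to the other: a
    substitution in (T) or (R) makes a product followed by a division collapse
    by the identity already known, and what is left is an identity for the
    opposite side.  Precisely, (B) and (T) give (D), (D) and (R) give (B),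
    (C) and (T) give (A), and (A) and (R) give (C).  The second and fourth
    facts are the mirror images of the first and third under reversal of the
    multiplication and exchange of the two divisions.  In each of the eight
    cases these four implications supply every missing identity in a single
    step. *)

Section Transfer.

Context {Q : Type} {mul ldiv rdiv : Q -> Q -> Q}.

(** Take the dividend [y * x] in (T): the inner quotient [y \ (y * x)] is [x]
    by (B). *)
Lemma idD_of_idB_idT : idB mul ldiv -> idT ldiv rdiv -> idD mul rdiv.
Proof.
  intros B T x y.
  pose proof (T (mul y x) y) as H. now rewrite B in H.
Qed.

Lemma idB_of_idD_idR : idD mul rdiv -> idR ldiv rdiv -> idB mul ldiv.
Proof.
  intros D R x y.
  pose proof (R (mul x y) y) as H. now rewrite D in H.
Qed.

(** Divide [y] on the right by [x \ y] and multiply back: (C) returns [y],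
    while (T) identifies the quotient with [x]. *)
Lemma idA_of_idC_idT : idC mul rdiv -> idT ldiv rdiv -> idA mul ldiv.
Proof.
  intros C T x y.
  pose proof (C (ldiv x y) y) as H. now rewrite T in H.
Qed.

Lemma idC_of_idA_idR : idA mul ldiv -> idR ldiv rdiv -> idC mul rdiv.
Proof.
  intros A R x y.
  pose proof (A (rdiv y x) y) as H. now rewrite R in H.
Qed.

End Transfer.

Theorem corollary1 (Q : Type) (mul ldiv rdiv : Q -> Q -> Q) :
  (idA mul ldiv -> idC mul rdiv -> idB mul ldiv -> idT ldiv rdiv ->
     is_quasigroup mul ldiv rdiv) /\
  (idC mul rdiv -> idB mul ldiv -> idD mul rdiv -> idT ldiv rdiv ->
     is_quasigroup mul ldiv rdiv) /\
  (idA mul ldiv -> idC mul rdiv -> idD mul rdiv -> idR ldiv rdiv ->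
     is_quasigroup mul ldiv rdiv) /\
  (idA mul ldiv -> idB mul ldiv -> idD mul rdiv -> idR ldiv rdiv ->
     is_quasigroup mul ldiv rdiv) /\
  (idA mul ldiv -> idB mul ldiv -> idT ldiv rdiv -> idR ldiv rdiv ->
     is_quasigroup mul ldiv rdiv) /\
  (idA mul ldiv -> idD mul rdiv -> idT ldiv rdiv -> idR ldiv rdiv ->
     is_quasigroup mul ldiv rdiv) /\
  (idC mul rdiv -> idB mul ldiv -> idT ldiv rdiv -> idR ldiv rdiv ->
     is_quasigroup mul ldiv rdiv) /\
  (idC mul rdiv -> idD mul rdiv -> idT ldiv rdiv -> idR ldiv rdiv ->
     is_quasigroup mul ldiv rdiv).
Proof.
  assert (quasigroup : idA mul ldiv -> idC mul rdiv -> idB mul ldiv ->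
            idD mul rdiv -> is_quasigroup mul ldiv rdiv)
    by (intros; now constructor).
  repeat apply conj; intros; apply quasigroup;
    eauto using idD_of_idB_idT, idB_of_idD_idR, idA_of_idC_idT, idC_of_idA_idR.
Qed.
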